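(* Let $f$ be a probability density on $\mathbb R$ with domain $D$ and cumulative distribution function $F$, and let $q(x,y)$ be a proposal, defined and positive for $x,y\in D$, such that $q(x,\cdot)$ is a probability density on $D$ for each $x\in D$. Assume that $q(x,y)$ is bounded from above on its support, that the support is continuous (i.e. $D$ is an interval), and that for some constant $a>0$, $q(x,y)\ge a f(y)$ for all $x,y\in D$. Then the Metropolis-Hastings algorithm with proposal $q$ and invariant density $f$ generates an exponentially $\rho$-mixing Markov chain. Moreover, if $f$ is strictly positive (on $D$), then the generated Markov chain is geometrically ergodic; and if $f$ is bounded away from zero on a set of full measure, i.e. there is $\delta>0$ with $f(F^{-1}(u))\ge\delta$ for $u$ in a subset of $[0,1]$ of Lebesgue measure $1$, then the generated Markov chain is uniformly mixing ($\phi$-mixing).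
   Context: Standing assumption: the invariant density $f$ is strictly positive on its domain $D\subset\mathbb R$. The Metropolis-Hastings algorithm with proposal $q$ and invariant density $f$ is the Markov chain on $D$ with transition kernel $$P(x,dy)=q(x,y)\alpha(x,y)\,dy+\Big(1-\int q(x,y)\alpha(x,y)\,dy\Big)\delta_x(dy),\qquad \alpha(x,y)=\min\Big\{\frac{f(y)q(y,x)}{f(x)q(x,y)},1\Big\},$$ where $\delta_x$ is the point mass at $x$. $F^{-1}$ is the (quantile) inverse of $F$. Mixing properties refer to the stationary chain $(X_n)_{n\in\mathbb Z}$, whose marginal density is $f$. For $\sigma$-fields $\mathscr A,\mathscr B$ put $\rho(\mathscr A,\mathscr B)=\sup\{\mathrm{corr}(g,h): g\in L^2(\mathscr A), h\in L^2(\mathscr B)\}$ and $\phi(\mathscr A,\mathscr B)=\sup\{|P(B|A)-P(B)|: B\in\mathscr B, A\in\mathscr A, P(A)>0\}$; $\rho_n,\phi_n$ are these coefficients with $\mathscr A=\sigma(X_i,i\le0)$, $\mathscr B=\sigma(X_i,i\ge n)$. The chain is exponentially $\rho$-mixing if $\rho_n\le K r^n$ for all $n\ge1$ for some $K<\infty$, $r\in(0,1)$; it is uniformly mixing ($\phi$-mixing) if $\phi_n\to0$. The chain is geometrically ergodic if there are $b\in(0,1)$ and a function $W$ with $\mathbb E(W(X_0))<\infty$ such that for all $n\in\mathbb N$ and almost every $x$, $\sup_{B}|P(X_n\in B|X_0=x)-P(X_n\in B)|\le b^nW(x)$, the supremum being over Borel sets $B$; this is equivalent to exponential $\beta$-mixing,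 i.e. exponential decay of $\beta_n=\mathbb E\sup_{B\in\mathscr B}|P(B|\mathscr A)-P(B)|$. *)

(* Defs.v *)
From HB Require Import structures.
From mathcomp Require Import all_boot all_order all_algebra.
From mathcomp Require Import all_classical all_reals all_analysis.

Set Implicit Arguments.
Unset Strict Implicit.
Unset Printing Implicit Defensive.

Import Order.TTheory GRing.Theory Num.Theory.
Import numFieldNormedType.Exports.

Local Open Scope classical_set_scope.
Local Open Scope ring_scope.

(* The density is a function on the whole line which vanishes outside its
   domain D and is strictly positive on D. *)
Definition density_with_domain (R : realType) (D : set R) (f : R -> R) : Prop :=
  [/\ measurable_fun setT f,
      (forall x, D x -> 0 < f x),
      (forall x, ~ D x -> f x = 0) &
      (\int[lebesgue_measure]_x (f x)%:E = 1)%E].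

(* Only the values of q on D `*` D matter. *)
Definition proposal (R : realType) (D : set R) (q : R -> R -> R) : Prop :=
  [/\ measurable_fun (D `*` D) (fun z : R * R => q z.1 z.2),
      (forall x y, D x -> D y -> 0 < q x y) &
      (forall x, D x -> (\int[lebesgue_measure]_(y in D) (q x y)%:E = 1)%E)].

Definition density_cdf (R : realType) (f : R -> R) (t : R) : \bar R :=
  (\int[lebesgue_measure]_(x in `]-oo, t]) (f x)%:E)%E.

(* Meaningful for 0 < u < 1: at other points [inf] may take its default value. *)
Definition quantile (R : realType) (f : R -> R) (u : R) : R :=
  inf [set t : R | (u%:E <= density_cdf f t)%E].

Definition mh_accept (R : realType) (f : R -> R) (q : R -> R -> R) (x y : R) : R :=
  Num.min (f y * q y x / (f x * q x y)) 1.

(* P(x, B), meaningful for x in D. *)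
Definition mh_kernel (R : realType) (D : set R) (f : R -> R) (q : R -> R -> R)
    (x : R) (B : set R) : \bar R :=
  (\int[lebesgue_measure]_(y in D `&` B) (q x y * mh_accept f q x y)%:E
   + (1 - \int[lebesgue_measure]_(y in D) (q x y * mh_accept f q x y)%:E)
     * \d_x B)%E.

(* The sigma-field generated by the X_i whose index satisfies I. *)
Definition sigma_of (R : realType) d (T : measurableType d)
    (P : probability T R) (X : int -> {RV P >-> R}) (I : set int) : set (set T) :=
  <<s [set A | exists i, I i /\
         exists B : set R, measurable B /\ A = X i @^-1` B] >>.

(* Stationary two-sided chain: every marginal has density f, and conditionally
   on sigma(X_i, i <= n) the law of X_(n+1) is the Metropolis-Hastings kernel
   at X_n. *)
Definition mh_chain (R : realType) (D : set R) (f : R -> R) (q : R -> R -> R)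
    d (T : measurableType d) (P : probability T R)
    (X : int -> {RV P >-> R}) : Prop :=
  (forall (n : int) (B : set R), measurable B ->
     P (X n @^-1` B) = (\int[lebesgue_measure]_(x in B) (f x)%:E)%E) /\
  (forall (n : int) (A : set T) (B : set R),
     sigma_of X [set i | i <= n] A -> measurable B ->
     P (A `&` X (n + 1) @^-1` B) =
       (\int[P]_(w in A) mh_kernel D f q (X n w) B)%E).

Section mixing.
Context (R : realType) d (T : measurableType d) (P : probability T R).

Definition L2_sub (A : set (set T)) (g : T -> R) : Prop :=
  (forall B : set R, measurable B -> A (g @^-1` B)) /\ g \in Lfun P 2%:E.

(* Equal to 0 when g or h is almost surely constant, since x / 0 = 0. *)
Definition corr (g h : T -> R) : R :=
  fine (covariance P g h) /
    (Num.sqrt (fine 'V_P[g]) * Num.sqrt (fine 'V_P[h])).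

Definition rho_coef (A B : set (set T)) : \bar R :=
  ereal_sup [set r | exists g h, [/\ L2_sub A g, L2_sub B h & r = (corr g h)%:E]].

Definition phi_coef (A B : set (set T)) : \bar R :=
  ereal_sup [set r | exists E F, [/\ A E, B F, (0 < P E)%E &
    r = `| fine (P (E `&` F)) / fine (P E) - fine (P F) |%:E]].

Variable X : int -> {RV P >-> R}.

Definition rho_n (n : nat) : \bar R :=
  rho_coef (sigma_of X [set i | i <= 0]) (sigma_of X [set i | n%:Z <= i]).

Definition phi_n (n : nat) : \bar R :=
  phi_coef (sigma_of X [set i | i <= 0]) (sigma_of X [set i | n%:Z <= i]).

Definition exponentially_rho_mixing : Prop :=
  exists K r : R, [/\ 0 < r, r < 1 &
    forall n : nat, (1 <= n)%N -> (rho_n n <= (K * r ^+ n)%:E)%E].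

Definition phi_mixing : Prop := phi_n n @[n --> \oo] --> 0%E.

(* k x B is a version of P(Z in B | Y = x). *)
Definition regular_conditional_law (Y Z : {RV P >-> R}) (k : R.-pker R ~> R) : Prop :=
  forall A B : set R, measurable A -> measurable B ->
    P (Y @^-1` A `&` Z @^-1` B) = (\int[distribution P Y]_(x in A) k x B)%E.

(* k n x B stands for P(X_n in B | X_0 = x): on the real line such regular
   versions exist, and are unique up to a null set of x for the law of X_0. *)
Definition geometrically_ergodic : Prop :=
  exists k : nat -> R.-pker R ~> R,
    (forall n : nat, regular_conditional_law (X 0) (X n%:Z) (k n)) /\
    exists (b : R) (W : R -> R),
      [/\ 0 < b, b < 1, measurable_fun setT W,
          ('E_P[W \o X 0%R] < +oo)%E &
          forall n : nat, {ae distribution P (X 0), forall x,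
            (ereal_sup [set `| k n x B - P (X n%:Z @^-1` B) | | B in measurable]
              <= (b ^+ n * W x)%:E)%E}].

End mixing.

(* Main.v *)
Require Import Defs.
From HB Require Import structures.
From mathcomp Require Import all_boot all_order all_algebra.
From mathcomp Require Import all_classical all_reals all_analysis measurable_realfun.
From mathcomp Require Import ring lra.
Set Implicit Arguments.
Unset Strict Implicit.
Unset Printing Implicit Defensive.
Import Order.TTheory GRing.Theory Num.Theory.
Import numFieldNormedType.Exports.
Local Open Scope classical_set_scope.
Local Open Scope ring_scope.

(** On D the density of an accepted move is
    q(x,y) alpha(x,y) = min (q(x,y), f(y) q(y,x) / f(x)), and q >= a f bounds
    both terms of the minimum below by a f(y) ([mh_density_minor]).  The
    Metropolis-Hastings kernel K therefore satisfies Doeblin's condition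
    K(x, .) >= a mu, and the minorizing measure mu = f dy is the invariant law
    itself.

    Writing K = a mu + (1 - a) Q, the kernel Q preserves mu, so that an
    induction on n gives K^n(x, .) >= c_n mu with c_n = 1 - (1 - a)^n
    ([kernel_power_minor]).  Applied to complements as well, this bounds the
    total variation distance of K^n(x, .) to mu by (1 - a)^n uniformly in x,
    which is geometric ergodicity with a constant W.

    The Markov property turns the bound on K^n into
      P(A and B) >= c_n P(A) P(B)
    for A in sigma(X_i, i <= 0) and B in sigma(X_i, i >= n)
    ([markov_lower_psi_mixing]).  Any event B of the future of n has a
    conditional probability given the past of n of the form psi(X_n)
    ([future_conditioned_by]): this holds for cylinders by integrating one
    coordinate at a time against K, and the events with this property form a
    Dynkin system.

    Both mixing bounds come from that one inequality.  Dividing by P(A), and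
    using it for the complement of B, gives phi_n <= (1 - a)^n.  For rho_n, let
    G and H be centred with unit variance, measurable with respect to the past
    and to the future.  Their joint law minus c_n times the product of their
    laws is a positive measure, and integrating (x - y)^2 against it gives
    2 - 2 E[GH] - 2 c_n >= 0, that is, corr(G, H) <= (1 - a)^n
    ([corr_le_dominates]). *)

(** * Correlation of variables whose joint law dominates independence *)

Lemma expectation_finite_values d (T : measurableType d) (R : realType)
    (P : probability T R) (S : eqType) (W : T -> S) (r : seq S) (phi : S -> R) :
  uniq r -> (forall w, W w \in r) ->
  (forall v, measurable [set w | W w = v]) ->
  'E_P[phi \o W]%E = (\sum_(v <- r) phi v * fine (P [set w | W w = v]))%:E.
Proof.
move=> ur Wr mW.
have -> : phi \o W =
    \sum_(g <- [seq phi v \o* \1_[set w | W w = v] | v <- r]) g :> (T -> R).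
  apply/funext => w; rewrite big_map fct_sumE (bigD1_seq (W w))//=.
  rewrite indicE mem_set//= mul1r big1 ?addr0// => v /negP vW.
  by rewrite indicE memNset ?mul0r// => /= /eqP; rewrite eq_sym.
have L1 v : (\1_[set w | W w = v] : T -> R) \in Lfun P 1.
  apply/Lfun1_integrable; apply/integrable_indic => //.
rewrite expectation_sum; last first.
  by move=> g /mapP[v _ ->]; exact: Lfun_scale.
rewrite big_map -sumEFin; apply: eq_bigr => v _.
rewrite expectationZl// expectation_indic// EFinM fineK// fin_num_measure//.
Qed.

Section simple_approximation.
(* makes the approximating simple functions coerce to functions *)
Import HBNNSimple.

(** The bound by |x| makes dominated convergence applicable to u_k(G) for a
    square integrable G. *)
Lemma simple_approximation_id (R : realType) : exists u : nat -> R -> R,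
  [/\ forall k, measurable_fun setT (u k),
      forall k x, `|u k x| <= `|x|,
      forall x, u k x @[k --> \oo] --> x &
      forall k, finite_set (range (u k))].
Proof.
have mp : measurable_fun [set: R] (EFin \o (fun x : R => Num.max x 0)).
  by apply/measurable_EFinP; exact: measurable_maxr.
have mn : measurable_fun [set: R] (EFin \o (fun x : R => Num.max (- x) 0)).
  by apply/measurable_EFinP; apply: measurable_maxr => //; exact: measurable_oppr.
pose p := nnsfun_approx measurableT mp.
pose n := nnsfun_approx measurableT mn.
have pn0 k x : 0 <= p k x /\ 0 <= n k x by split; exact: fun_ge0.
have ple k x : p k x <= Num.max x 0.
  rewrite -lee_fin /p nnsfun_approxE; apply: (le_approx (D := setT)) => //.
  by move=> y _; rewrite lee_fin le_max lexx orbT.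
have nle k x : n k x <= Num.max (- x) 0.
  rewrite -lee_fin /n nnsfun_approxE; apply: (le_approx (D := setT)) => //.
  by move=> y _; rewrite lee_fin le_max lexx orbT.
have pc x : p k x @[k --> \oo] --> Num.max x 0.
  apply: (fine_cvg (f := fun k => (p k x)%:E)).
  apply: (cvg_nnsfun_approx measurableT mp) => //.
  by move=> y _; rewrite lee_fin le_max lexx orbT.
have nc x : n k x @[k --> \oo] --> Num.max (- x) 0.
  apply: (fine_cvg (f := fun k => (n k x)%:E)).
  apply: (cvg_nnsfun_approx measurableT mn) => //.
  by move=> y _; rewrite lee_fin le_max lexx orbT.
exists (fun k x => p k x - n k x); split.
- by move=> k; exact: measurable_funB.
- move=> k x; have [p0 n0] := pn0 k x.
  have := ple k x; have := nle k x.
  have [x0|x0] := leP 0 x.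
    rewrite (max_idPr _); last by rewrite oppr_le0.
    by move=> n1 p1; rewrite (ger0_norm x0) ler_norml; apply/andP; split; lra.
  rewrite (max_idPl _); last by rewrite oppr_ge0 ltW.
  by move=> n1 p1; rewrite (ler0_norm (ltW x0)) ler_norml; apply/andP; split; lra.
- move=> x; suff E : Num.max x 0 - Num.max (- x) 0 = x.
    by rewrite -[X in _ --> X]E; exact: (cvgB (pc x) (nc x)).
  have [x0|x0] := leP 0 x.
    by rewrite (max_idPr _) ?subr0// oppr_le0.
  by rewrite (max_idPl _) ?sub0r ?opprK// oppr_ge0 ltW.
- move=> k.
  apply: (sub_finite_set _ (finite_image2 (fun a b => a - b)
    (fimfunP (p k)) (fimfunP (n k)))).
  by move=> _ [x _ <-] /=; exists (p k x); [exists x|exists (n k x) => //; exists x].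
Qed.

End simple_approximation.

Section quadratic.
Context d (T : measurableType d) (R : realType) (P : probability T R).
Local Notation e Y := (fine (expectation P Y)).

Definition dominates_independent (c : R) (G H : T -> R) :=
  forall U V : set R, measurable U -> measurable V ->
    c * (fine (P (G @^-1` U)) * fine (P (H @^-1` V))) <=
      fine (P (G @^-1` U `&` H @^-1` V)).

(** For finitely many values both sides are finite sums over pairs (x, y) of
    values; they compare term by term because the weights (x - y)^2 are
    nonnegative. *)
Lemma quadratic_bound_finite (c : R) (G H : T -> R) (r s : seq R) :
  uniq r -> uniq s -> (forall w, G w \in r) -> (forall w, H w \in s) ->
  measurable_fun setT G -> measurable_fun setT H ->
  dominates_independent c G H ->
  c * (e (fun w => G w ^+ 2) + e (fun w => H w ^+ 2) - 2 * (e G * e H))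
    <= e (fun w => (G w - H w) ^+ 2).
Proof.
move=> ur us Gr Hs mG mH GH.
have mGv v : measurable [set w | G w = v].
  by rewrite -[X in measurable X]setTI; exact: (mG measurableT [set v]).
have mHv v : measurable [set w | H w = v].
  by rewrite -[X in measurable X]setTI; exact: (mH measurableT [set v]).
pose p v := fine (P [set w | G w = v]); pose q v := fine (P [set w | H w = v]).
have EG phi : e (phi \o G) = \sum_(v <- r) phi v * p v.
  by rewrite (@expectation_finite_values _ _ _ P _ G r).
have EH phi : e (phi \o H) = \sum_(v <- s) phi v * q v.
  by rewrite (@expectation_finite_values _ _ _ P _ H s).
have p1 : \sum_(v <- r) p v = 1.
  have := EG (cst 1); rewrite expectation_cst /= => ->.
  by apply: eq_bigr => v _; rewrite mul1r.
have q1 : \sum_(v <- s) q v = 1.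
  have := EH (cst 1); rewrite expectation_cst /= => ->.
  by apply: eq_bigr => v _; rewrite mul1r.
have -> : e (fun w => (G w - H w) ^+ 2) = \sum_(x <- r) \sum_(y <- s)
    (x - y) ^+ 2 * fine (P ([set w | G w = x] `&` [set w | H w = y])).
  have := @expectation_finite_values _ T R P _ (fun w => (G w, H w))
    [seq (x, y) | x <- r, y <- s] (fun z => (z.1 - z.2) ^+ 2).
  have E z : [set w | (G w, H w) = z] = [set w | G w = z.1] `&` [set w | H w = z.2].
    by apply/seteqP; case: z => x y; split => w /= [-> ->].
  move=> ->; first last.
  - by move=> v; rewrite E; exact: measurableI.
  - by move=> w; exact: (allpairs_f pair (Gr w) (Hs w)).
  - by apply: allpairs_uniq => // -[x1 y1] [x2 y2] _ _ /= [-> ->].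
  rewrite /= big_allpairs_dep/=.
  by apply: eq_bigr => x _; apply: eq_bigr => y _; rewrite E.
rewrite -[e (fun w => G w ^+ 2)]/(e ((fun x => x ^+ 2) \o G)) EG.
rewrite -[e (fun w => H w ^+ 2)]/(e ((fun x => x ^+ 2) \o H)) EH.
rewrite -[e G]/(e (id \o G)) EG -[e H]/(e (id \o H)) EH.
apply: (@le_trans _ _ (\sum_(x <- r) \sum_(y <- s)
    (x - y) ^+ 2 * (c * (p x * q y)))); last first.
  apply: ler_sum => x _; apply: ler_sum => y _.
  by apply: ler_wpM2l; [exact: sqr_ge0|exact: (GH [set x] [set y])].
rewrite le_eqVlt; apply/orP; left; apply/eqP.
transitivity (c * (\sum_(x <- r) \sum_(y <- s) (x ^+ 2 * p x * q y
    + p x * (y ^+ 2 * q y) - 2 * (x * p x * (y * q y))))); last first.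
  rewrite mulr_sumr; apply: eq_bigr => x _; rewrite mulr_sumr.
  by apply: eq_bigr => y _; ring.
congr (c * _).
under [RHS]eq_bigr do rewrite sumrB big_split /= -!mulr_sumr q1 mulr1.
rewrite sumrB big_split /= -!mulr_suml p1 mul1r; congr (_ - _).
by rewrite -mulr_sumr; congr (2 * _); rewrite mulr_suml.
Qed.

End quadratic.

Section correlation.
Context d (T : measurableType d) (R : realType) (P : probability T R).
Local Notation e Y := (fine (expectation P Y)).

Lemma cvg_expectation_dominated (Y : nat -> T -> R) (Y0 Z : T -> R) :
  (forall k, measurable_fun setT (Y k)) -> measurable_fun setT Y0 ->
  (forall w, Y k w @[k --> \oo] --> Y0 w) ->
  (forall k w, `|Y k w| <= Z w) -> Z \in Lfun P 1 ->
  e (Y k) @[k --> \oo] --> e Y0.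
Proof.
move=> mY mY0 YY0 YZ /Lfun1_integrable iZ.
have mEY k : measurable_fun setT (EFin \o Y k) by exact/measurable_EFinP.
have mEY0 : measurable_fun setT (EFin \o Y0) by exact/measurable_EFinP.
have cEY : {ae P, forall w, setT w -> (EFin \o Y k) w @[k --> \oo] --> (EFin \o Y0) w}.
  by apply: aeW => w _; apply: cvg_EFin; [exact: nearW|exact: YY0].
have dEY : {ae P, forall w k, setT w -> (`|(EFin \o Y k) w| <= (EFin \o Z) w)%E}.
  by apply: aeW => w k _; rewrite /= lee_fin.
have [iY0 _ cvgY] := dominated_convergence measurableT mEY mEY0 cEY iZ dEY.
apply: fine_cvg; rewrite fineK; last first.
  by apply: expectation_fin_num; exact/Lfun1_integrable.
rewrite unlock; exact: cvgY.
Qed.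

(** Passage to the limit from finitely many values: replacing G and H by u(G)
    and u(H), with u simple, preserves the hypothesis on the joint law because
    u^-1 of a Borel set is a Borel set. *)
Lemma quadratic_bound (c : R) (G H : T -> R) :
  G \in Lfun P 2%:E -> H \in Lfun P 2%:E -> dominates_independent P c G H ->
  c * (e (fun w => G w ^+ 2) + e (fun w => H w ^+ 2) - 2 * (e G * e H))
    <= e (fun w => (G w - H w) ^+ 2).
Proof.
move=> G2 H2 GH.
have Pfin : P setT \is a fin_num by rewrite fin_num_measure.
have G1 := Lfun_subset12 Pfin G2; have H1 := Lfun_subset12 Pfin H2.
have mG : measurable_fun setT G by move: G2; rewrite inE => /andP[]; rewrite inE.
have mH : measurable_fun setT H by move: H2; rewrite inE => /andP[]; rewrite inE.
have [u [mu ule uc uf]] := simple_approximation_id R.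
have muG k : measurable_fun setT (u k \o G) by exact: measurableT_comp.
have muH k : measurable_fun setT (u k \o H) by exact: measurableT_comp.
have sqr_le k x : u k x ^+ 2 <= x ^+ 2.
  rewrite -[leLHS]real_normK ?num_real// -[leRHS]real_normK ?num_real//.
  by rewrite ler_pXn2r ?nnegrE.
have cvg_sqr (y : nat -> R) (l : R) :
    y k @[k --> \oo] --> l -> y k ^+ 2 @[k --> \oo] --> l ^+ 2.
  by move=> yl; rewrite expr2; under eq_fun do rewrite expr2; exact: cvgM.
have cGG : e (fun w => u k (G w) ^+ 2) @[k --> \oo] --> e (fun w => G w ^+ 2).
  apply: (@cvg_expectation_dominated _ _ (fun w => G w ^+ 2)).
  - by move=> k; exact: (measurable_funX 2 (muG k)).
  - exact: (measurable_funX 2 mG).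
  - by move=> w; apply: cvg_sqr; exact: uc.
  - by move=> k w; rewrite ger0_norm ?sqr_ge0.
  - by under eq_fun do rewrite expr2; exact: Lfun2_mul_Lfun1.
have cHH : e (fun w => u k (H w) ^+ 2) @[k --> \oo] --> e (fun w => H w ^+ 2).
  apply: (@cvg_expectation_dominated _ _ (fun w => H w ^+ 2)).
  - by move=> k; exact: (measurable_funX 2 (muH k)).
  - exact: (measurable_funX 2 mH).
  - by move=> w; apply: cvg_sqr; exact: uc.
  - by move=> k w; rewrite ger0_norm ?sqr_ge0.
  - by under eq_fun do rewrite expr2; exact: Lfun2_mul_Lfun1.
have cG : e (u k \o G) @[k --> \oo] --> e G.
  apply: (@cvg_expectation_dominated _ _ (Num.norm \o G)) => //.
  - by move=> w; exact: uc.
  - by move=> k w; exact: ule.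
  - exact: Lfun_norm.
have cH : e (u k \o H) @[k --> \oo] --> e H.
  apply: (@cvg_expectation_dominated _ _ (Num.norm \o H)) => //.
  - by move=> w; exact: uc.
  - by move=> k w; exact: ule.
  - exact: Lfun_norm.
have cGH : e (fun w => (u k (G w) - u k (H w)) ^+ 2) @[k --> \oo]
    --> e (fun w => (G w - H w) ^+ 2).
  apply: (@cvg_expectation_dominated _ _ (2 \o* (G \* G) \+ 2 \o* (H \* H))).
  - by move=> k; exact: (measurable_funX 2 (measurable_funB (muG k) (muH k))).
  - exact: (measurable_funX 2 (measurable_funB mG mH)).
  - by move=> w; apply: cvg_sqr; apply: cvgB; exact: uc.
  - move=> k w /=; rewrite ger0_norm ?sqr_ge0//.
    have := sqr_le k (G w); have := sqr_le k (H w).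
    have := sqr_ge0 (u k (G w) + u k (H w)); nra.
  - by apply: rpredD; apply: Lfun_scale => //; exact: Lfun2_mul_Lfun1.
have C1 : c * (e (fun w => u k (G w) ^+ 2) + e (fun w => u k (H w) ^+ 2)
      - 2 * (e (u k \o G) * e (u k \o H))) @[k --> \oo] -->
    c * (e (fun w => G w ^+ 2) + e (fun w => H w ^+ 2) - 2 * (e G * e H)).
  apply: cvgMl_tmp; apply: cvgB; first exact: cvgD.
  by apply: cvgMl_tmp; exact: cvgM.
apply: (ler_cvg_to C1 cGH); apply: nearW => k.
have /finite_seqP[r Er] := uf k.
have ur x : u k x \in undup r.
  by rewrite mem_undup; have : range (u k) (u k x) by [exists x]; rewrite Er.
apply: (@quadratic_bound_finite _ _ _ _ c (u k \o G) (u k \o H)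
  (undup r) (undup r)) => //.
- exact: undup_uniq.
- exact: undup_uniq.
- by move=> w; exact: ur.
- by move=> w; exact: ur.
- move=> U V mU mV; apply: (GH (u k @^-1` U) (u k @^-1` V)).
    by rewrite -[X in measurable X]setTI; exact: mu.
  by rewrite -[X in measurable X]setTI; exact: mu.
Qed.

(** The quadratic bound for the standardized variables reads
    2 c <= 2 - 2 corr P G H. *)
Lemma corr_le_dominates (c : R) (G H : T -> R) : c <= 1 ->
  G \in Lfun P 2%:E -> H \in Lfun P 2%:E -> dominates_independent P c G H ->
  corr P G H <= 1 - c.
Proof.
move=> c1 G2 H2 GH.
have Pfin : P setT \is a fin_num by rewrite fin_num_measure.
have G1 := Lfun_subset12 Pfin G2; have H1 := Lfun_subset12 Pfin H2.
pose A := G \- cst (e G); pose B := H \- cst (e H).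
have A2 : A \in Lfun P 2%:E by rewrite rpredB ?lee1n//= => _; exact: Lfun_cst.
have B2 : B \in Lfun P 2%:E by rewrite rpredB ?lee1n//= => _; exact: Lfun_cst.
have A1 := Lfun_subset12 Pfin A2; have B1 := Lfun_subset12 Pfin B2.
have eA : e A = 0.
  by rewrite expectationB ?Lfun_cst// expectation_cst fineB ?expectation_fin_num//= subrr.
have eB : e B = 0.
  by rewrite expectationB ?Lfun_cst// expectation_cst fineB ?expectation_fin_num//= subrr.
have AA := Lfun2_mul_Lfun1 A2 A2; have BB := Lfun2_mul_Lfun1 B2 B2.
have AB := Lfun2_mul_Lfun1 A2 B2.
have cvE : fine (covariance P G H) = e (A \* B) by rewrite unlock.
have vG : fine (variance P G) = e (A \* A) by rewrite /variance unlock.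
have vH : fine (variance P H) = e (B \* B) by rewrite /variance unlock.
rewrite /corr cvE vG vH.
have vA0 : 0 <= e (A \* A) by rewrite -vG fine_ge0// variance_ge0.
have vB0 : 0 <= e (B \* B) by rewrite -vH fine_ge0// variance_ge0.
set a := Num.sqrt _; set b := Num.sqrt _.
(* an almost surely constant variable: the quotient is 0 by convention *)
have [ab0|] := eqVneq (a * b) 0; first by rewrite ab0 invr0 mulr0 subr_ge0.
rewrite mulf_eq0 negb_or => /andP[a0 b0].
have aE : a ^+ 2 = e (A \* A) by rewrite sqr_sqrtr.
have bE : b ^+ 2 = e (B \* B) by rewrite sqr_sqrtr.
have Z1 k Y : Y \in Lfun P 1 -> e (k \o* Y) = k * e Y.
  by move=> Y1; rewrite expectationZl// fineM// expectation_fin_num.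
have Q : c * (e (fun w => (a^-1 \o* A) w ^+ 2) + e (fun w => (b^-1 \o* B) w ^+ 2)
      - 2 * (e (a^-1 \o* A) * e (b^-1 \o* B)))
    <= e (fun w => ((a^-1 \o* A) w - (b^-1 \o* B) w) ^+ 2).
  apply: quadratic_bound; [by apply: Lfun_scale; rewrite ?ler1n..|].
  move=> U V mU mV.
  have mf k m : measurable_fun [set: R] (fun x : R => (x - m) * k).
    by apply: measurable_funM => //; exact: measurable_funB.
  rewrite -[_ @^-1` U]/(G @^-1` ((fun x => (x - e G) * a^-1) @^-1` U)).
  rewrite -[_ @^-1` V]/(H @^-1` ((fun x => (x - e H) * b^-1) @^-1` V)).
  apply: GH; rewrite -[X in measurable X]setTI; exact: mf.
rewrite !Z1// eA eB in Q.
have EA : e (fun w => (a^-1 \o* A) w ^+ 2) = 1.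
  rewrite (_ : (fun w => _) = (a^-1 ^+ 2) \o* (A \* A)) ?Z1//.
    by rewrite -aE -exprMn mulVf ?expr1n.
  by apply/funext => w /=; ring.
have EB : e (fun w => (b^-1 \o* B) w ^+ 2) = 1.
  rewrite (_ : (fun w => _) = (b^-1 ^+ 2) \o* (B \* B)) ?Z1//.
    by rewrite -bE -exprMn mulVf ?expr1n.
  by apply/funext => w /=; ring.
have EAB : e (fun w => ((a^-1 \o* A) w - (b^-1 \o* B) w) ^+ 2) =
    2 - 2 * (e (A \* B) / (a * b)).
  rewrite (_ : (fun w => _) = (a^-1 ^+ 2) \o* (A \* A) \+ (b^-1 ^+ 2) \o* (B \* B)
      \- (2 * (a^-1 * b^-1)) \o* (A \* B)); last first.
    by apply/funext => w /=; ring.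
  rewrite expectationB ?rpredD ?Lfun_scale//.
  rewrite expectationD ?Lfun_scale//.
  rewrite fineB ?fin_numD ?expectation_fin_num ?Lfun_scale//.
  rewrite fineD ?expectation_fin_num ?Lfun_scale//.
  rewrite !Z1// -aE -bE -!exprMn !mulVf// !expr1n invfM.
  by ring.
rewrite EA EB EAB in Q.
move: Q; set z := _ / _; lra.
Qed.

End correlation.

(** * Restricted laws and composition with kernels *)

Section restricted_law.
Context d d' (T : measurableType d) (S : measurableType d') (R : realType).
Variables (m : {measure set T -> \bar R}) (A : set T) (mA : measurable A).
Variable Y : {mfun T >-> S}.
Local Open Scope ereal_scope.

(** The law of Y on the event A, not normalized.  Conditioning the chain on a
    past event A is done through these measures on the state space, where
    kernels act. *)
Definition restricted_law (B : set S) : \bar R :=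
  pushforward (mrestr m mA) Y B.

Let restricted_law0 : restricted_law set0 = 0.
Proof. exact: measure0. Qed.

Let restricted_law_ge0 B : 0 <= restricted_law B.
Proof. exact: measure_ge0. Qed.

Let restricted_law_sigma_additive : semi_sigma_additive restricted_law.
Proof. exact: measure_semi_sigma_additive. Qed.

HB.instance Definition _ := isMeasure.Build _ _ _ restricted_law
  restricted_law0 restricted_law_ge0 restricted_law_sigma_additive.

Lemma restricted_lawE B : restricted_law B = m (A `&` Y @^-1` B).
Proof. by rewrite /restricted_law /pushforward /mrestr setIC. Qed.

End restricted_law.

Section restricted_integral.
Local Open Scope ereal_scope.

Lemma ge0_integral_mrestr d (T : measurableType d) (R : realType)
    (m : {measure set T -> \bar R}) (A : set T) (mA : measurable A)
    (f : T -> \bar R) :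
  measurable_fun setT f -> (forall x, 0 <= f x) ->
  \int[mrestr m mA]_x f x = \int[m]_(x in A) f x.
Proof.
move=> mf f0.
rewrite (@ge0_negligible_integral _ _ _ (mrestr m mA) setT (~` A))//; last 2 first.
- exact: measurableC.
- by rewrite /= /mrestr setICl measure0.
rewrite setTD setCK.
by apply: eq_measure_integral => B mB BA; rewrite /= /mrestr setIidl.
Qed.

Lemma ge0_integral_restricted_law d d' (T : measurableType d)
    (S : measurableType d') (R : realType) (m : {measure set T -> \bar R})
    (A : set T) (mA : measurable A) (Y : {mfun T >-> S}) (f : S -> \bar R) :
  measurable_fun setT f -> (forall x, 0 <= f x) ->
  \int[restricted_law m mA Y]_y f y = \int[m]_(x in A) f (Y x).
Proof.
move=> mf f0.
have -> : \int[restricted_law m mA Y]_y f y =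
    \int[pushforward (mrestr m mA) Y]_y f y by exact: eq_measure_integral.
rewrite ge0_integral_pushforward//.
rewrite preimage_setT ge0_integral_mrestr//; first exact: measurableT_comp.
by move=> x; exact: f0.
Qed.

End restricted_integral.

Section constant_kernel.
Context d (S : measurableType d) (R : realType).
Variable m : {finite_measure set S -> \bar R}.

(** A measure seen as a kernel from a one-point space, so that composition of
    kernels applies to it. *)
Definition constant_kernel (_ : unit) : {measure set S -> \bar R} := m.

Let measurable_constant_kernel U : measurable U ->
  measurable_fun setT (constant_kernel ^~ U).
Proof. by []. Qed.

HB.instance Definition _ := isKernel.Build _ _ _ _ _ constant_kernel
  measurable_constant_kernel.

Let constant_kernel_uub : measure_fam_uub constant_kernel.
Proof.
exists (fine (m setT) + 1)%R => x; rewrite /constant_kernel.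
by rewrite -[ltLHS]fineK ?fin_num_measure// lte_fin ltrDl.
Qed.

HB.instance Definition _ := Kernel_isFinite.Build _ _ _ _ _ constant_kernel
  constant_kernel_uub.

End constant_kernel.

(** A measure identity m' = m K, known on sets, extended to integrals of
    nonnegative functions. *)
Lemma ge0_integral_bind d d' (S : measurableType d) (S' : measurableType d')
    (R : realType) (m : {finite_measure set S -> \bar R}) (K : R.-spker S ~> S')
    (m' : {measure set S' -> \bar R}) (phi : S' -> \bar R) :
  (forall B, measurable B -> m' B = \int[m]_y K y B)%E ->
  measurable_fun setT phi -> (forall x, 0 <= phi x)%E ->
  (\int[m']_z phi z = \int[m]_y \int[K y]_z phi z)%E.
Proof.
move=> mE mphi phi0.
have := @integral_kcomp _ _ _ _ _ _ _ (constant_kernel m)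
  (@kernel.kernel_snd _ _ _ unit _ _ _ K) tt phi phi0 mphi.
move=> <-; apply: eq_measure_integral => B mB _.
by rewrite mE.
Qed.

Section finite_restricted_law.
Context d d' (T : measurableType d) (S : measurableType d') (R : realType).
Variables (m : {finite_measure set T -> \bar R}) (A : set T) (mA : measurable A).
Variable Y : {mfun T >-> S}.

Let restricted_law_fin : fin_num_fun (restricted_law m mA Y).
Proof.
move=> B mB; rewrite restricted_lawE fin_num_measure//.
by apply: measurableI => //; exact: measurable_funPTI.
Qed.

HB.instance Definition _ := Measure_isFinite.Build _ _ _
  (restricted_law m mA Y) restricted_law_fin.

End finite_restricted_law.

Section kernel_powers.
Context d (S : measurableType d) (R : realType).
Local Open Scope ereal_scope.

Section composition.
Variables (K L : R.-pker S ~> S).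

Definition pcomp := mkcomp_noparam K L.

HB.instance Definition _ := SubProbabilityKernel.on pcomp.

Let pcomp_setT x : pcomp x setT = 1.
Proof.
have -> : pcomp x setT = \int[K x]__ 1.
  by apply: eq_integral => y _; exact: prob_kernel.
by rewrite integral_cst// mul1e prob_kernel.
Qed.

HB.instance Definition _ := isProbabilityKernel.Build _ _ _ _ _ pcomp pcomp_setT.

End composition.

(** The first step is the one that is split off: the induction hypothesis can
    then be used from time n + 1, for an event of the past of n, which also
    belongs to the past of n + 1. *)
Fixpoint kernel_power (K : R.-pker S ~> S) (n : nat) : R.-pker S ~> S :=
  if n is n'.+1 then [the R.-pker S ~> S of pcomp K (kernel_power K n')]
  else [the R.-pker S ~> S of kdirac (@measurable_id _ S setT)].

End kernel_powers.

(** * Markov chains whose kernel dominates the invariant law *)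

Section sigma_of_lemmas.
Context d (T : measurableType d) (R : realType) (P : probability T R).
Variable X : int -> {RV P >-> R}.

Lemma sigma_of_measurable I A : sigma_of X I A -> measurable A.
Proof.
apply: smallest_sub; first exact: sigma_algebra_measurable.
by move=> _ [i [_ [B [mB ->]]]]; exact: measurable_funPTI.
Qed.

Lemma sigma_of_setI I A B :
  sigma_of X I A -> sigma_of X I B -> sigma_of X I (A `&` B).
Proof.
exact: (@measurableI _ (g_sigma_algebraType [set A | exists i, I i /\
  exists B : set R, measurable B /\ A = X i @^-1` B])).
Qed.

Lemma sigma_ofT I : sigma_of X I setT.
Proof.
exact: (@measurableT _ (g_sigma_algebraType [set A | exists i, I i /\
  exists B : set R, measurable B /\ A = X i @^-1` B])).
Qed.

Lemma sigma_of_preimage (I : set int) i B :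
  I i -> measurable B -> sigma_of X I (X i @^-1` B).
Proof. by move=> Ii mB; apply: sub_sigma_algebra; exists i; split => //; exists B. Qed.

Lemma sigma_of_sub (I J : set int) : I `<=` J -> sigma_of X I `<=` sigma_of X J.
Proof.
move=> IJ; apply: sub_sigma_algebra2 => A [i [Ii iA]].
by exists i; split => //; exact: IJ.
Qed.

End sigma_of_lemmas.

Section markov_chain.
Context d (T : measurableType d) (R : realType) (P : probability T R).
Variables (X : int -> {RV P >-> R}) (K : R.-pker R ~> R).
Local Notation past n := (sigma_of X [set i : int | (i <= n)%R]).
Local Open Scope ereal_scope.

(** The Markov property with its conditioning on the whole past, expressed on
    the line: the law of X_(n+1) on a past event is the law of X_n on this event
    followed by K. *)
Definition markov_with_kernel := forall (n : int) A (mA : measurable A) B,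
  past n A -> measurable B ->
  P (A `&` X (n + 1)%R @^-1` B) = \int[restricted_law P mA (X n)]_y K y B.

Hypothesis markovK : markov_with_kernel.

Lemma markov_step (n : int) A (mA : measurable A) (phi : R -> \bar R) : past n A ->
  measurable_fun setT phi -> (forall x, 0 <= phi x) ->
  \int[restricted_law P mA (X (n + 1)%R)]_y phi y =
  \int[restricted_law P mA (X n)]_y \int[K y]_z phi z.
Proof.
move=> FA mphi phi0; apply: ge0_integral_bind => // B mB.
exact: etrans (restricted_lawE _ _ _ _) (markovK _ _ _).
Qed.

Lemma markov_power k (n : int) A (mA : measurable A) B : past n A -> measurable B ->
  P (A `&` X (n + k%:Z)%R @^-1` B) =
  \int[restricted_law P mA (X n)]_y kernel_power K k y B.
Proof.
move=> + mB; elim: k n A mA => [|k IH] n A mA FA.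
  rewrite addr0 (eq_integral (fun y => (\1_B y)%:E)); last first.
    by move=> y _; rewrite /= /kdirac /= diracE indicE.
  by rewrite integral_indic// setIT; exact/esym/restricted_lawE.
rewrite (_ : n + k.+1%:Z = (n + 1) + k%:Z)%R; last by rewrite -addrA -PoszD add1n.
rewrite (IH _ _ mA); last first.
  by apply: sigma_of_sub FA => i /= /le_trans; apply; rewrite lerDl.
by rewrite markov_step//; exact: measurable_kernel.
Qed.

Definition stationary := forall (n : int) B, measurable B ->
  P (X n @^-1` B) = distribution P (X 0%R) B.

Hypothesis stationaryX : stationary.

Let mu := distribution P (X 0%R).

Lemma restricted_lawT (n : int) B : measurable B ->
  restricted_law P measurableT (X n) B = mu B.
Proof. by move=> mB; rewrite restricted_lawE setTI; exact: stationaryX. Qed.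

Lemma kernel_power_invariant k B : measurable B ->
  \int[mu]_y kernel_power K k y B = mu B.
Proof.
move=> mB; have -> : mu B = P (setT `&` X (0 + k%:Z)%R @^-1` B).
  by rewrite setTI add0r; exact/esym/stationaryX.
rewrite (markov_power _ measurableT)//; last exact: sigma_ofT.
by apply: eq_measure_integral => C mC _; exact/esym/restricted_lawT.
Qed.

Variable a : R.
Hypotheses (a0 : (0 <= a)%R) (a1 : (a <= 1)%R).
Hypothesis minorK : forall x B, measurable B -> a%:E * mu B <= K x B.

(** One more step from K^k >= c mu: the excess K^k(., B) - c mu(B) is
    nonnegative, hence its integral against K(x, .) is at least a times its
    integral against mu, which is (1 - c) mu(B) by invariance.  The new constant
    is c + a (1 - c) = 1 - (1 - a)^(k+1). *)
Lemma kernel_power_minor k x B : measurable B ->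
  (1 - (1 - a) ^+ k)%:E * mu B <= kernel_power K k x B.
Proof.
move=> mB; elim: k x => [|k IH] x.
  by rewrite expr0 subrr mul0e measure_ge0.
set c := (1 - (1 - a) ^+ k)%R in IH *.
have c1 : (c <= 1)%R by rewrite /c lerBlDr lerDl exprn_ge0// subr_ge0.
have muB : mu B \is a fin_num by rewrite fin_num_measure.
pose b := (c * fine (mu B))%R.
have bE : b%:E = c%:E * mu B by rewrite EFinM fineK.
pose h y := kernel_power K k y B.
have mh : measurable_fun setT h by exact: measurable_kernel.
pose g y := h y - b%:E.
have g0 y : 0 <= g y by rewrite sube_ge0// bE; exact: IH.
have mg : measurable_fun setT g by exact: emeasurable_funB.
have hE (m : {measure set R -> \bar R}) : m setT = 1 ->
    \int[m]_y h y = b%:E + \int[m]_y g y.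
  move=> m1; rewrite (eq_integral (fun y => b%:E + g y)); last first.
    by move=> y _; rewrite /g addeC subeK.
  have [b0|b0] := leP 0%R b.
    by rewrite ge0_integralD//= integral_cst// m1 mule1.
  have : (0 <= b)%R.
    by rewrite /b mulr_ge0 ?fine_ge0// subr_ge0 exprn_ile1// ?subr_ge0// lerBlDr lerDl.
  by rewrite leNgt b0.
rewrite [leRHS](hE (K x)); last exact: prob_kernel.
have hmu : mu B = b%:E + \int[mu]_y g y.
  by rewrite -(hE mu (probability_setT _)); exact/esym/kernel_power_invariant.
have gK : a%:E * \int[mu]_y g y <= \int[K x]_y g y.
  rewrite -(@ge0_integral_mscale _ _ _ mu setT measurableT (NngNum a0))//.
  by apply: ge0_le_measure_integral => // B' mB'; exact: minorK.
apply: le_trans (leeD2l _ gK).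
have gE : \int[mu]_y g y = (fine (mu B) - b)%:E.
  by rewrite EFinB fineK// hmu [b%:E + _]addeC addeK.
rewrite gE -(fineK muB) -!EFinM -EFinD lee_fin /b exprS /c le_eqVlt.
by apply/orP; left; apply/eqP; ring.
Qed.

Lemma markov_minor k (n : int) A (mA : measurable A) B : past n A -> measurable B ->
  (1 - (1 - a) ^+ k)%:E * P A * mu B <= restricted_law P mA (X (n + k%:Z)%R) B.
Proof.
move=> FA mB.
rewrite [leRHS](etrans (restricted_lawE _ _ _ _) (markov_power k mA FA mB)).
apply: (@le_trans _ _ (\int[restricted_law P mA (X n)]_y
    ((1 - (1 - a) ^+ k)%:E * mu B))).
  have -> : (1 - (1 - a) ^+ k)%:E * P A * mu B =
      (1 - (1 - a) ^+ k)%:E * mu B * restricted_law P mA (X n) setT.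
    by rewrite restricted_lawE preimage_setT setIT; exact: muleAC.
  by rewrite integral_cst.
apply: ge0_le_integral => //.
- move=> y _; apply: mule_ge0 => //.
  by rewrite lee_fin subr_ge0 exprn_ile1// ?subr_ge0// lerBlDr lerDl.
- exact: measurable_kernel.
- by move=> y _; exact: kernel_power_minor.
Qed.

End markov_chain.

(** * Conditional probability of future events *)

Section markov_future.
Context d (T : measurableType d) (R : realType) (P : probability T R).
Variable X : int -> {RV P >-> R}.
Local Notation past n := (sigma_of X [set i : int | (i <= n)%R]).
Local Open Scope ereal_scope.

(** psi(X_n) is a version of the conditional probability of B given the past
    of n: the future event B depends on the past through X_n only. *)
Definition conditioned_by (n : int) (B : set T) := measurable B /\
  exists psi : R -> \bar R, [/\ measurable_fun setT psi, forall x, 0 <= psi x &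
    forall A (mA : measurable A), past n A ->
      P (A `&` B) = \int[restricted_law P mA (X n)]_y psi y].

Lemma conditioned_byT n : conditioned_by n setT.
Proof.
split; first exact: measurableT.
exists (cst 1); split => // A mA FA.
rewrite integral_cst// mul1e setIT.
by rewrite [RHS]restricted_lawE preimage_setT setIT.
Qed.

(** Otherwise the past event that psi(X_n) exceeds 1 would have a smaller
    probability than its intersection with B. *)
Lemma conditioned_by_le1 n B psi : measurable B ->
  measurable_fun setT psi -> (forall x, 0 <= psi x) ->
  (forall A (mA : measurable A), past n A ->
      P (A `&` B) = \int[restricted_law P mA (X n)]_y psi y) ->
  forall A (mA : measurable A), {ae restricted_law P mA (X n), forall y, psi y <= 1}.
Proof.
move=> mB mpsi psi0 psiE A mA.
pose E := [set y | 1 < psi y].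
have mE : measurable E.
  by rewrite -[E]setTI; exact: emeasurable_fun_o_infty.
(* psi > 1 on E, yet the integral of psi on C is at most P C: the excess g
   integrates to 0 *)
pose C := X n @^-1` E.
have mC : measurable C by exact: measurable_funPTI.
have FC : past n C by apply: sigma_of_preimage => //=.
suff C0 : P C = 0.
  exists E; split => //.
    rewrite [LHS]restricted_lawE; apply: (subset_measure0 _ _ _ C0) => //.
    by apply: measurableI.
  by move=> y /= /negP; rewrite -ltNge.
pose nu := restricted_law P mC (X n).
pose g y := maxe (psi y - 1) 0.
have g0 y : 0 <= g y by rewrite /g le_max lexx orbT.
have mg : measurable_fun setT g.
  by apply: measurable_maxe => //; exact: emeasurable_funB.
have psi_ge : \int[nu]_y ((\1_E y)%:E + g y) <= \int[nu]_y psi y.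
  apply: ge0_le_integral => //.
  - by move=> y _; rewrite adde_ge0// lee_fin.
  - apply: emeasurable_funD => //; apply/measurable_EFinP; exact: measurable_indic.
  - move=> y _; rewrite /g indicE; have [Ey|Ey] := pselect (E y).
      rewrite mem_set// max_l; last by rewrite sube_ge0// ltW.
      by rewrite addeC; change (psi y - 1 + 1 <= psi y); rewrite subeK.
    rewrite memNset// add0e max_r// sube_le0.
    by move/negP: Ey; rewrite -leNgt.
have nuE : \int[nu]_y (\1_E y)%:E = P C.
  rewrite integral_indic// setIT [LHS]restricted_lawE -/C setIid.
  by [].
have PC : \int[nu]_y psi y <= P C.
  by rewrite -(psiE C mC FC) le_measure// ?inE//; exact: measurableI.
have ig0 : \int[nu]_y g y = 0.
  have : P C + \int[nu]_y g y <= P C.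
    apply: le_trans PC; apply: le_trans psi_ge; rewrite ge0_integralD//.
    - by rewrite nuE.
    - by apply/measurable_EFinP; exact: measurable_indic.
  rewrite -{2}[P C]adde0 leeD2lE ?fin_num_measure// => ig.
  by apply/eqP; rewrite eq_le ig integral_ge0.
have ae0 : ae_eq nu setT g (cst 0).
  apply/ae_eq_integral_abs => //.
  by rewrite -[RHS]ig0; apply: eq_integral => y _; rewrite gee0_abs.
have [N [mN N0 EN]] := ae0.
have : nu E = 0.
  apply: (subset_measure0 _ _ _ N0) => // y Ey; apply: EN => /= /(_ Logic.I).
  rewrite /g max_l; last by rewrite sube_ge0// ltW.
  move=> gy; have : 0 < psi y - 1 by rewrite sube_gt0.
  by rewrite gy ltxx.
by rewrite [X in X = _]restricted_lawE -/C setIid.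
Qed.

Lemma conditioned_byC n B : conditioned_by n B -> conditioned_by n (~` B).
Proof.
move=> [mB [psi [mpsi psi0 psiE]]]; split; first exact: measurableC.
have mpsi' : measurable_fun setT (fun y => maxe (1 - psi y) 0).
  by apply: measurable_maxe => //; exact: emeasurable_funB.
(* 1 - psi may be negative on a null set; the positive part is not *)
exists (fun y => maxe (1 - psi y) 0); split => //.
  by move=> y; rewrite le_max lexx orbT.
move=> A mA FA; set nu := restricted_law P mA (X n).
have E1 : P (A `&` B) + \int[nu]_y maxe (1 - psi y) 0 = P A.
  rewrite (psiE A mA FA) -ge0_integralD//; last first.
    by move=> y _; rewrite le_max lexx orbT.
  transitivity (\int[nu]_y cst 1 y).
    apply: ae_eq_integral => //; first exact: emeasurable_funD.
    have := conditioned_by_le1 mB mpsi psi0 psiE mA.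
    apply: filterS => y psi1 _; rewrite max_l; last by rewrite sube_ge0 ?orbT.
    by rewrite addeC subeK// ge0_fin_numE// (le_lt_trans psi1) ?ltry.
  rewrite integral_cst// mul1e [LHS]restricted_lawE preimage_setT setIT.
  by [].
have PB : P (A `&` B) \is a fin_num by rewrite fin_num_measure//; exact: measurableI.
have PCB : P (A `&` B) + P (A `&` ~` B) = P A.
  by rewrite addeC -setDE -measureDI.
transitivity (P A - P (A `&` B)).
  by rewrite -PCB [X in X - _]addeC addeK.
by rewrite -E1 [X in X - _]addeC addeK.
Qed.

Lemma conditioned_byU n (B : (set T)^nat) : trivIset setT B ->
  (forall k, conditioned_by n (B k)) -> conditioned_by n (\bigcup_k B k).
Proof.
move=> tB BP; split; first by apply: bigcup_measurable => k _; have [] := BP k.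
have mB k : measurable (B k) by have [] := BP k.
have /choice[psi psiP] k := (BP k).2.
have psi0 k x : 0 <= psi k x by have [] := psiP k.
have mpsi k : measurable_fun setT (psi k) by have [] := psiP k.
exists (fun y => \sum_(k <oo) psi k y); split.
- exact: ge0_emeasurable_sum.
- by move=> y; exact: nneseries_ge0.
- move=> A mA FA; rewrite integral_nneseries// setI_bigcupr measure_bigcup//.
  + transitivity (\sum_(k <oo) P (A `&` B k)).
      by apply: eq_eseriesl => k; rewrite in_setT.
    by apply: eq_eseriesr => k _; have [_ _ ->] := psiP k.
  + by move=> k _; exact: measurableI.
  + exact: trivIset_setIl.
Qed.

End markov_future.

Section markov_mixing.
Context d (T : measurableType d) (R : realType) (P : probability T R).
Variables (X : int -> {RV P >-> R}) (K : R.-pker R ~> R).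
Local Notation past n := (sigma_of X [set i : int | (i <= n)%R]).
Local Notation future n := (sigma_of X [set i : int | (n <= i)%R]).
Local Open Scope ereal_scope.

Hypothesis markovK : markov_with_kernel X K.

Lemma past_subS n : past n `<=` past (n + 1)%R.
Proof. by apply: sigma_of_sub => i /= /le_trans; apply; rewrite lerDl. Qed.

(** Given the past of n, first integrate psi(X_(n+1)) against K, then restrict
    to the values of X_n in S. *)
Lemma conditioned_by_step n S B : measurable S ->
  conditioned_by X (n + 1)%R B -> conditioned_by X n (X n @^-1` S `&` B).
Proof.
move=> mS [mB [psi [mpsi psi0 psiE]]].
have mXS : measurable (X n @^-1` S) by exact: measurable_funPTI.
split; first exact: measurableI.
have mKpsi : measurable_fun setT (fun y => \int[K y]_z psi z).
  apply: measurable_fun_integral_kernel => // U mU.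
  exact: measurable_kernel.
have Kpsi0 y : 0 <= \int[K y]_z psi z by exact: integral_ge0.
exists ((fun y => \int[K y]_z psi z) \_ S); split.
- exact/(measurable_restrictT _ _).1/measurable_funTS.
- by move=> y; exact: erestrict_ge0.
- move=> A mA FA.
  have mA' : measurable (A `&` X n @^-1` S) by exact: measurableI.
  have FA' : past n (A `&` X n @^-1` S).
    by apply: sigma_of_setI => //; apply: sigma_of_preimage => //=.
  rewrite setIA (psiE _ mA'); last exact: past_subS.
  rewrite (markov_step markovK)// -integral_mkcond.
  rewrite -[RHS](ge0_integral_mrestr _ mS mKpsi Kpsi0).
  apply: eq_measure_integral => C mC _.
  rewrite [LHS]restricted_lawE /= /mrestr restricted_lawE.
  by rewrite -setIA -preimage_setI [S `&` C]setIC.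
Qed.

(** The events X_n in S_0, ..., X_(n+k) in S_k: a pi-system that generates the
    future of n.  The inductive form peels off the earliest coordinate, which is
    the one that [conditioned_by_step] handles. *)
Inductive cylinder : int -> set T -> Prop :=
| cylinderT n : cylinder n setT
| cylinderS n S B : measurable S -> cylinder (n + 1)%R B ->
    cylinder n (X n @^-1` S `&` B).

Lemma cylinder_setI n : setI_closed (cylinder n).
Proof.
move=> B C cB; elim: cB C => [m C|m S B' mS cB' IH C cC]; first by rewrite setTI.
case: cC mS cB' IH => [k|k S' C' mS' cC'] mS cB' IH.
  by rewrite setIT; exact: cylinderS.
rewrite setIACA -preimage_setI; apply: cylinderS; first exact: measurableI.
exact: IH.
Qed.

Lemma cylinder_conditioned_by n B : cylinder n B -> conditioned_by X n B.
Proof.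
elim=> [m|m S B' mS _ IH]; first exact: conditioned_byT.
exact: conditioned_by_step.
Qed.

Lemma cylinder_preimage n k S : measurable S -> cylinder n (X (n + k%:Z)%R @^-1` S).
Proof.
move=> mS; elim: k n => [|k IH] n.
  rewrite addr0 -[X n @^-1` S]setIT; apply: cylinderS => //; exact: cylinderT.
rewrite -[_ @^-1` S]setTI -(preimage_setT (X n)).
apply: cylinderS => //.
by rewrite (_ : n + k.+1%:Z = n + 1 + k%:Z)%R// -addrA -PoszD add1n.
Qed.

Lemma future_conditioned_by n : future n `<=` conditioned_by X n.
Proof.
have : future n `<=` <<s cylinder n >>.
  apply: sub_sigma_algebra2 => _ [i [/= ni [S [mS ->]]]].
  have -> : i = (n + `|i - n|%N%:Z)%R.
    by rewrite gez0_abs ?subr_ge0// [RHS]addrC subrK.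
  exact: cylinder_preimage.
move=> /subset_trans; apply; apply: lambda_system_subset => //.
- exact: cylinder_setI.
- apply/dynkin_lambda_system; split.
  + exact: conditioned_byT.
  + by move=> B; exact: conditioned_byC.
  + by move=> B; exact: conditioned_byU.
- exact: cylinder_conditioned_by.
Qed.

Hypothesis stationaryX : stationary X.
Variable a : R.
Hypotheses (a0 : (0 <= a)%R) (a1 : (a <= 1)%R).
Hypothesis minorK :
  forall x B, measurable B -> a%:E * distribution P (X 0%R) B <= K x B.

(** With psi(X_k) the conditional probability of B, P(A and B) is the integral
    of psi against the law of X_k on A, and that law is at least
    (1 - (1 - a)^k) P(A) mu. *)
Lemma markov_lower_psi_mixing k A B : past 0 A -> future k%:Z B ->
  ((1 - (1 - a) ^+ k) * (fine (P A) * fine (P B)) <= fine (P (A `&` B)))%R.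
Proof.
move=> FA FB.
have [mB [psi [mpsi psi0 psiE]]] := future_conditioned_by FB.
have mA := sigma_of_measurable FA.
set c := (1 - (1 - a) ^+ k)%R.
have c0 : (0 <= c)%R.
  by rewrite subr_ge0 exprn_ile1// ?subr_ge0// lerBlDr lerDl.
have FAk : past k%:Z A by apply: sigma_of_sub FA => i /= /le_trans; apply.
rewrite -lee_fin fineK; last by rewrite fin_num_measure//; exact: measurableI.
rewrite (psiE A mA FAk) EFinM EFinM !fineK ?fin_num_measure//.
pose mu := distribution P (X 0%R).
have cA0 : (0 <= c * fine (P A))%R by rewrite mulr_ge0// fine_ge0.
have -> : P B = \int[mu]_y psi y.
  rewrite -[B]setTI (psiE _ measurableT); last exact: sigma_ofT.
  apply: eq_measure_integral => C mC _; exact: (restricted_lawT stationaryX).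
have -> : c%:E * (P A * \int[mu]_y psi y) =
    \int[mscale (NngNum cA0) mu]_y psi y.
  rewrite ge0_integral_mscale//= EFinM fineK ?muleA//.
  by rewrite fin_num_measure.
apply: ge0_le_measure_integral => // C mC.
rewrite /= /mscale /= EFinM fineK ?fin_num_measure//.
have := @markov_minor _ _ _ _ _ _ markovK stationaryX _ a0 a1 minorK k 0 A mA C FA mC.
by rewrite add0r.
Qed.

End markov_mixing.

(** * The Metropolis-Hastings kernel as a probability kernel *)

Section density_completion.
Context (R : realType) (p : R -> R -> R).
Local Open Scope ereal_scope.
Local Notation leb := (@lebesgue_measure R).

Hypothesis mp : measurable_fun setT (fun z : R * R => p z.1 z.2).
Hypothesis p0 : forall x y, (0 <= p x y)%R.
Hypothesis p1 : forall x, \int[leb]_y (p x y)%:E <= 1.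

Let mpE : measurable_fun [set: R * R] (fun z : R * R => (p z.1 z.2)%:E).
Proof. exact/measurable_EFinP. Qed.

Let mpx x : measurable_fun [set: R] (fun y : R => (p x y)%:E).
Proof. exact: (measurable_fun_pair2 x mpE). Qed.

(** The Borel sets of the line and those on which the Lebesgue measure is built
    are the same sets for two different structures of measurable type; this
    measure lives on the former. *)
Definition density_measure (x : R) (B : set R) : \bar R :=
  \int[leb]_(y in B) (p x y)%:E.

Let density_measure0 x : density_measure x set0 = 0.
Proof. exact: integral_set0. Qed.

Let density_measure_ge0 x B : 0 <= density_measure x B.
Proof. by apply: integral_ge0 => y _; rewrite lee_fin. Qed.

Let density_measure_additive x : semi_sigma_additive (density_measure x).
Proof.
apply: (@semi_sigma_additive_nng_induced _ _ R leb) => [|y].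
  exact: mpx.
by rewrite lee_fin.
Qed.

HB.instance Definition _ x := isMeasure.Build _ _ _ (density_measure x)
  (density_measure0 x) (density_measure_ge0 x) (@density_measure_additive x).

Lemma density_deficit_ge0 x : (0 <= 1 - fine (density_measure x setT))%R.
Proof.
rewrite subr_ge0 -lee_fin fineK; first exact: p1.
by rewrite ge0_fin_numE// (le_lt_trans (p1 x)) ?ltry.
Qed.

(** A subprobability density completed to a probability by an atom at the
    current point: for the Metropolis-Hastings chain, the rejected moves. *)
Definition completed (x : R) : {measure set R -> \bar R} :=
  measure_add (density_measure x)
    (mscale (NngNum (density_deficit_ge0 x)) (dirac x)).

Lemma completedE x B : completed x B =
  \int[leb]_(y in B) (p x y)%:E + (1 - \int[leb]_y (p x y)%:E) * \d_x B.
Proof.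
apply: (etrans (measure_addE _ _ _)); congr (_ + _ * _).
rewrite EFinB fineK//.
by rewrite ge0_fin_numE// (le_lt_trans (p1 x)) ?ltry.
Qed.

Lemma measurable_density_measure B : measurable B ->
  measurable_fun setT (density_measure ^~ B).
Proof.
move=> mB.
have mBp : measurable_fun [set: R * R]
    (fun z : R * R => (p z.1 z.2 * \1_B z.2)%:E).
  apply/measurable_EFinP; apply: measurable_funM => //.
  by apply: measurableT_comp => //; exact: measurable_indic.
have pB0 (z : R * R) : 0 <= (p z.1 z.2 * \1_B z.2)%:E.
  by rewrite lee_fin mulr_ge0.
have := @measurable_fun_fubini_tonelli_F _ _ R (measurableTypeR R) R leb
  (fun z => (p z.1 z.2 * \1_B z.2)%:E) mBp pB0.
apply: eq_measurable_fun => x _.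
rewrite /fubini_F /density_measure [RHS]integral_mkcond; apply: eq_integral => y _.
by rewrite /= patchE indicE; case: ifPn => _; rewrite ?mulr1 ?mulr0.
Qed.

Let measurable_completed B : measurable B ->
  measurable_fun setT (completed ^~ B).
Proof.
move=> mB.
rewrite (_ : completed ^~ B = fun x => density_measure x B +
    (1 - density_measure x setT) * (\1_B x)%:E); last first.
  by apply/funext => x; rewrite completedE diracE indicE.
apply: emeasurable_funD; first exact: measurable_density_measure.
apply: emeasurable_funM.
  by apply: emeasurable_funB => //; exact: measurable_density_measure.
by apply/measurable_EFinP; exact: measurable_indic.
Qed.

HB.instance Definition _ := isKernel.Build _ _ _ _ _ completed
  measurable_completed.

Let completed_setT x : completed x setT = 1.
Proof.
have fm : density_measure x setT \is a fin_num.
  rewrite ge0_fin_numE//; apply: le_lt_trans (p1 x) _; exact: ltry.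
by rewrite completedE diracT mule1 addeC subeK.
Qed.

HB.instance Definition _ := Kernel_isProbability.Build _ _ _ _ _ completed
  completed_setT.

Definition completed_kernel : R.-pker R ~> R := [the R.-pker R ~> R of completed].

End density_completion.

Section metropolis_hastings_kernel.
Context (R : realType) (D : set R) (f : R -> R) (q : R -> R -> R).
Local Notation leb := (@lebesgue_measure R).

(** The density of an accepted move from a point x of D.  From a point outside
    D, where the acceptance ratio is meaningless, the value f y makes the
    minorization by a f hold at every point of the line. *)
Definition mh_density (x y : R) : R :=
  if x \in D then (if y \in D then q x y * mh_accept f q x y else 0) else f y.

Hypothesis f_density : density_with_domain D f.
Hypothesis q_proposal : proposal D q.

Let mf : measurable_fun setT f. Proof. by case: f_density. Qed.
Let f_gt0 x : D x -> 0 < f x. Proof. by case: f_density => _ + _ _; exact. Qed.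
Let f_eq0 x : ~ D x -> f x = 0. Proof. by case: f_density => _ _ + _; exact. Qed.
Let q_gt0 x y : D x -> D y -> 0 < q x y.
Proof. by case: q_proposal => _ + _; exact. Qed.

Lemma density_ge0 x : 0 <= f x.
Proof. by have [/f_gt0/ltW|/f_eq0->] := pselect (D x). Qed.

Lemma measurable_domain : measurable D.
Proof.
have -> : D = f @^-1` `]0, +oo[.
  apply/seteqP; split => x /=; rewrite in_itv/= andbT.
    exact: f_gt0.
  by move=> fx; apply: contrapT => /f_eq0 fx0; move: fx; rewrite fx0 ltxx.
by rewrite -[_ @^-1` _]setTI; exact: mf.
Qed.

Let q0 (z : R * R) : R := ((fun z : R * R => q z.1 z.2) \_ (D `*` D)) z.

Let q0E x y : D x -> D y -> q0 (x, y) = q x y.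
Proof. by move=> Dx Dy; rewrite /q0 patchE mem_set. Qed.

Let mq0 : measurable_fun [set: R * R] q0.
Proof.
have mDD : measurable (D `*` D) by apply: measurableX; exact: measurable_domain.
by apply/(measurable_restrictT _ mDD); case: q_proposal.
Qed.

Lemma measurable_mh_density :
  measurable_fun setT (fun z : R * R => mh_density z.1 z.2).
Proof.
have mq0s : measurable_fun [set: R * R] (fun z => q0 (z.2, z.1)).
  exact: (measurableT_comp mq0 (@measurable_swap _ _ R R)).
have mf1 : measurable_fun [set: R * R] (fun z => f z.1) by exact: measurableT_comp.
have mf2 : measurable_fun [set: R * R] (fun z => f z.2) by exact: measurableT_comp.
have mDC : measurable (~` D) by apply: measurableC; exact: measurable_domain.
(* q0 vanishes off D x D, so the first term does as well; the power -1 is the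
   inverse on the nonnegative reals *)
rewrite (_ : (fun z : R * R => mh_density z.1 z.2) = fun z =>
   q0 z * Num.min (f z.2 * q0 (z.2, z.1) * (f z.1 * q0 z) `^ (- 1)) 1
     + \1_(~` D) z.1 * f z.2); last first.
  apply/funext => -[x y]; rewrite /mh_density /=.
  have [Dx|Dx] := pselect (D x).
    have xDC : (x \in ~` D) = false by apply: memNset => /(_ Dx).
    rewrite (mem_set Dx) indicE xDC mul0r addr0.
    have [Dy|Dy] := pselect (D y).
      rewrite (mem_set Dy) !q0E// powR_inv1// mulr_ge0 ?density_ge0//.
      exact/ltW/q_gt0.
    by rewrite (memNset Dy) /q0 patchE memNset ?mul0r// => -[].
  rewrite (memNset Dx) /q0 patchE memNset ?mul0r ?add0r; last by case.
  by rewrite indicE mem_set// mul1r.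
apply: measurable_funD.
  apply: measurable_funM => //; apply: measurable_minr => //.
  apply: measurable_funM; first exact: measurable_funM.
  apply: (measurableT_comp (measurable_powR (R := R) (- 1))).
  exact: measurable_funM.
apply: measurable_funM => //.
by apply: measurableT_comp => //; exact: measurable_indic.
Qed.

Lemma mh_density_ge0 x y : 0 <= mh_density x y.
Proof.
rewrite /mh_density; case: ifPn => [/set_mem Dx|_]; last exact: density_ge0.
case: ifPn => [/set_mem Dy|//]; apply: mulr_ge0; first exact/ltW/q_gt0.
rewrite le_min ler01 andbT; apply: divr_ge0; apply: mulr_ge0;
  rewrite ?density_ge0//; exact/ltW/q_gt0.
Qed.

Lemma mh_density_mass x : (\int[leb]_y (mh_density x y)%:E <= 1)%E.
Proof.
have [Dx|Dx] := pselect (D x); last first.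
  have -> : (\int[leb]_y (mh_density x y)%:E = \int[leb]_y (f y)%:E)%E.
    by apply: eq_integral => y _; rewrite /mh_density memNset.
  by case: f_density => _ _ _ ->.
have [_ _ /(_ _ Dx) <-] := q_proposal.
rewrite [leRHS]integral_mkcond; apply: ge0_le_integral => //.
- by move=> y _; rewrite lee_fin mh_density_ge0.
- apply/measurable_EFinP.
  exact: (measurable_fun_pair2 x measurable_mh_density).
- rewrite (_ : _ \_ _ = fun y => (q0 (x, y))%:E).
    by apply/measurable_EFinP; exact: (measurable_fun_pair2 x mq0).
  apply/funext => y; rewrite patchE /q0 patchE.
  have [Dy|Dy] := pselect (D y); first by rewrite !mem_set.
  by rewrite !memNset// => -[].
- move=> y _; rewrite patchE /mh_density mem_set//.
  case: ifPn => // /set_mem Dy; rewrite lee_fin.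
  by rewrite ler_piMr ?ge_min ?lexx ?orbT// ltW// q_gt0.
Qed.

Definition mh_completed : R.-pker R ~> R :=
  completed_kernel measurable_mh_density mh_density_ge0 mh_density_mass.

Lemma mh_completedE x B : D x -> mh_kernel D f q x B = mh_completed x B.
Proof.
move=> Dx; rewrite [RHS]completedE /mh_kernel.
have E C : (\int[leb]_(y in D `&` C) (q x y * mh_accept f q x y)%:E =
    \int[leb]_(y in C) (mh_density x y)%:E)%E.
  rewrite integral_mkcondl; apply: eq_integral => y _.
  by rewrite patchE /mh_density (mem_set Dx); case: ifP.
rewrite E; congr (_ + (_ - _) * _)%E.
by rewrite -E setIT.
Qed.

(** The density is the minimum of q x y >= a f y and of
    f y q y x / f x >= f y (a f x) / f x. *)
Lemma mh_density_minor (a : R) x y : a <= 1 ->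
  (forall x y, D x -> D y -> a * f y <= q x y) -> a * f y <= mh_density x y.
Proof.
move=> a1 aq; rewrite /mh_density.
case: ifPn => [/set_mem Dx|_]; last by rewrite ler_piMl// density_ge0.
case: ifPn => [/set_mem Dy|/negP Dy]; last by rewrite f_eq0 ?mulr0// => /mem_set.
rewrite /mh_accept; have qxy := q_gt0 Dx Dy; have fx := f_gt0 Dx; have fy := f_gt0 Dy.
rewrite (minr_pMr _ _ (ltW qxy)) mulr1 le_min aq// andbT.
have -> : q x y * (f y * q y x / (f x * q x y)) = f y * (q y x / f x).
  by field; rewrite !gt_eqF.
by rewrite mulrC ler_pM2l// ler_pdivlMr// aq.
Qed.

Lemma mh_completed_minor (a : R) x B : 0 <= a -> a <= 1 ->
  (forall x y, D x -> D y -> a * f y <= q x y) -> measurable B ->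
  (a%:E * \int[leb]_(y in B) (f y)%:E <= mh_completed x B)%E.
Proof.
move=> a0 a1 aq mB.
have mfE : measurable_fun setT (EFin \o f) by exact/measurable_EFinP.
apply: (@le_trans _ _ (\int[leb]_(y in B) (mh_density x y)%:E)%E); last first.
  rewrite [leRHS]completedE leeDl// mule_ge0//.
  by rewrite sube_ge0 ?mh_density_mass// orbT.
rewrite -ge0_integralZl_EFin//; last 2 first.
- by move=> y _; rewrite lee_fin density_ge0.
- exact: (@measurable_funTS _ _ R _ B).
apply: ge0_le_integral => //.
- by move=> y _; rewrite mule_ge0// lee_fin density_ge0.
- by apply: emeasurable_funM => //; exact: measurable_funTS.
- apply: measurable_funTS; apply/measurable_EFinP.
  exact: (measurable_fun_pair2 x measurable_mh_density).
- by move=> y _; rewrite -EFinM lee_fin mh_density_minor.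
Qed.

End metropolis_hastings_kernel.

(** * Metropolis-Hastings chains *)

Section chain_of_kernel.
Context (R : realType) (D : set R) (f : R -> R) (q : R -> R -> R).
Context d (T : measurableType d) (P : probability T R).
Variable X : int -> {RV P >-> R}.
Hypothesis f_density : density_with_domain D f.
Hypothesis q_proposal : proposal D q.
Hypothesis X_chain : mh_chain D f q X.

Lemma mh_chain_stationary : stationary X.
Proof.
by move=> n B mB; have [XE _] := X_chain; rewrite XE//; exact/esym/XE.
Qed.

Lemma mh_chain_domain n : P (X n @^-1` (~` D)) = 0%E.
Proof.
have mDC : measurable (~` D) by apply: measurableC; exact: (measurable_domain f_density).
rewrite (X_chain.1 n _ mDC).
by apply: integral0_eq => x Dx; case: f_density => _ _ ->.
Qed.

(** The chain stays in D almost surely, and [mh_kernel] agrees with the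
    completed kernel on D; intersecting the past event with that of X_n being
    in D removes the points where [mh_kernel] may not even be measurable. *)
Lemma mh_chain_markov : markov_with_kernel X (mh_completed f_density q_proposal).
Proof.
move=> n A mA B FA mB.
have mD := measurable_domain f_density.
have mXD : measurable (X n @^-1` D) by exact: measurable_funPTI.
have FXD : sigma_of X [set i : int | (i <= n)%R] (X n @^-1` D).
  by apply: sigma_of_preimage => //=.
have inD C : measurable C -> P (A `&` X n @^-1` D `&` C) = P (A `&` C).
  move=> mC; rewrite -setIA [_ @^-1` D `&` C]setIC setIA.
  have mAC : measurable (A `&` C) by exact: measurableI.
  rewrite [RHS](measureDI _ mAC mXD) [X in _ = (X + _)%E](_ : _ = 0%E) ?add0e//.
  apply: (subset_measure0 _ _ _ (mh_chain_domain n)).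
  - exact: measurableD.
  - by apply: measurable_funPTI; exact: measurableC.
  - by move=> w [_].
have mA' : measurable (A `&` X n @^-1` D) by exact: measurableI.
rewrite -inD; last exact: measurable_funPTI.
have [_ ->] := X_chain; [|exact: sigma_of_setI|by []].
transitivity (\int[P]_(w in A `&` X n @^-1` D)
    (mh_completed f_density q_proposal (X n w) B))%E.
  by apply: eq_integral => w /set_mem [_ /= Dw]; exact: mh_completedE.
rewrite -(ge0_integral_restricted_law P mA' (X n)
  (measurable_kernel (mh_completed f_density q_proposal) B mB))//.
apply: eq_measure_integral => C mC _.
rewrite [LHS]restricted_lawE [RHS]restricted_lawE; apply: inD.
exact: measurable_funPTI.
Qed.

End chain_of_kernel.

(** The lower bound on the complementary event is an upper bound on the event;
    x and y are its two probabilities. *)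
Lemma dist_le_of_minor (R : realType) (c x y : R) : 0 <= c -> c <= 1 ->
  0 <= y -> y <= 1 -> c * y <= x -> c * (1 - y) <= 1 - x -> `|x - y| <= 1 - c.
Proof.
by move=> c0 c1 y0 y1 cy cy'; rewrite ler_norml; apply/andP; split; nra.
Qed.

Theorem theorem6 (R : realType) (D : set R) (f : R -> R) (q : R -> R -> R)
    (f_density : density_with_domain D f)
    (q_proposal : proposal D q)
    (q_bounded : exists M : R, forall x y, D x -> D y -> q x y <= M)
    (D_interval : is_interval D)
    (q_minor : exists a : R, 0 < a /\ forall x y, D x -> D y -> a * f y <= q x y)
    (d : measure_display) (T : measurableType d) (P : probability T R)
    (X : int -> {RV P >-> R})
    (X_chain : mh_chain D f q X) :
  [/\ exponentially_rho_mixing X,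
      (forall x, D x -> 0 < f x) -> geometrically_ergodic X &
      (exists delta : R, 0 < delta /\
         exists U : set R, [/\ measurable U, U `<=` `[0, 1],
           lebesgue_measure U = 1%E &
           forall u, U u -> delta <= f (quantile f u)]) ->
        phi_mixing X].
Proof.
have [a' [a'0 a'q]] := q_minor.
(* the rate of decay 1 - a has to be positive *)
pose a := Num.min a' 2^-1.
have a0 : 0 < a by rewrite /a lt_min a'0 invr_gt0 ltr0n.
have a2 : a <= 2^-1 by rewrite /a ge_min lexx orbT.
have a1 : a < 1 by rewrite (le_lt_trans a2)// invf_lt1 ?ltr0n// ltr1n.
have aq x y : D x -> D y -> a * f y <= q x y.
  move=> Dx Dy; apply: le_trans (a'q x y Dx Dy).
  by rewrite ler_wpM2r ?(density_ge0 f_density)// /a ge_min lexx.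
pose K := mh_completed f_density q_proposal.
have markovK := mh_chain_markov f_density q_proposal X_chain.
have statX := mh_chain_stationary X_chain.
have minorK x B : measurable B -> (a%:E * distribution P (X 0%R) B <= K x B)%E.
  move=> mB; have := mh_completed_minor f_density q_proposal x (ltW a0) (ltW a1) aq mB.
  by rewrite -(X_chain.1 0 B mB).
have r0 : 0 < 1 - a by rewrite subr_gt0.
have r1 : 1 - a < 1 by rewrite ltrBlDr ltrDl.
have rn01 n : 0 <= (1 - a) ^+ n /\ (1 - a) ^+ n <= 1.
  by split; [rewrite exprn_ge0 ?ltW|rewrite exprn_ile1 ?ltW].
have low n A B : sigma_of X [set i : int | i <= 0] A ->
    sigma_of X [set i : int | n%:Z <= i] B ->
    (1 - (1 - a) ^+ n) * (fine (P A) * fine (P B)) <= fine (P (A `&` B)).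
  exact: (markov_lower_psi_mixing markovK statX (ltW a0) (ltW a1) minorK).
split.
- exists 1, (1 - a); split => // n _; rewrite mul1r.
  apply: ge_ereal_sup => _ [g [h [[Ag g2] [Bh h2] ->]]]; rewrite lee_fin.
  have [rn0 rn1] := rn01 n.
  rewrite [leRHS](_ : _ = 1 - (1 - (1 - a) ^+ n)); last by rewrite subKr.
  apply: corr_le_dominates => //; first by rewrite gerBl.
  by move=> U V mU mV; apply: low; [exact: Ag|exact: Bh].
- move=> _; exists (kernel_power K); split.
    move=> n A B mA mB.
    have mXA : measurable (X 0 @^-1` A) by exact: measurable_funPTI.
    have FXA : sigma_of X [set i : int | i <= 0] (X 0 @^-1` A).
      by apply: sigma_of_preimage => //=.
    have := markov_power markovK n mXA FXA mB; rewrite add0r => ->.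
    have mKB := measurable_kernel (kernel_power K n) B mB.
    by rewrite -[RHS](ge0_integral_mrestr _ mA mKB).
  exists (1 - a), (cst 1); split => //.
    by rewrite (_ : _ \o _ = cst 1)// expectation_cst ltry.
  move=> n; apply: aeW => x; apply: ge_ereal_sup => _ [B mB <-].
  have [rn0 rn1] := rn01 n.
  have mBC : measurable (~` B) by exact: measurableC.
  have stB : P (X n%:Z @^-1` B) = distribution P (X 0%R) B by exact: statX.
  have kfin C : measurable C -> kernel_power K n x C \is a fin_num.
    move=> mC; rewrite ge0_fin_numE// (@le_lt_trans _ _ 1%E) ?ltry//.
    by rewrite -(prob_kernel (s := kernel_power K n) x) le_measure ?inE.
  have kC : kernel_power K n x (~` B) = (1 - kernel_power K n x B)%E.
    rewrite -(prob_kernel (s := kernel_power K n) x) -(setvU B).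
    rewrite measureU//; last exact: setICl.
    by rewrite addeK// kfin.
  have muC : distribution P (X 0%R) (~` B) = (1 - distribution P (X 0%R) B)%E.
    by rewrite probability_setC.
  have lo := kernel_power_minor markovK statX (ltW a0) (ltW a1) minorK n x mB.
  have loC := kernel_power_minor markovK statX (ltW a0) (ltW a1) minorK n x mBC.
  rewrite stB mulr1.
  have mufin : distribution P (X 0%R) B \is a fin_num by rewrite fin_num_measure.
  have mu1 : (distribution P (X 0%R) B <= 1)%E by exact: probability_le1.
  move: lo loC mu1; rewrite kC muC -(fineK mufin) -(fineK (kfin B mB)).
  rewrite -!EFinB -!EFinM !lee_fin => lo loC mu1.
  rewrite [leRHS](_ : _ = 1 - (1 - (1 - a) ^+ n)); last by rewrite subKr.
  apply: dist_le_of_minor => //; rewrite ?subr_ge0// ?gerBl//.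
  by rewrite fine_ge0.
- move=> _; rewrite /phi_mixing.
  apply: (@squeeze_cvge _ _ _ _ (cst 0%E) _ (fun n => ((1 - a) ^+ n)%:E)).
  + apply: nearW => n; apply/andP; split.
      apply: ereal_sup_ubound; exists setT, setT; split.
      * exact: sigma_ofT.
      * exact: sigma_ofT.
      * by rewrite probability_setT.
      * by rewrite setTI probability_setT /= divr1 subrr normr0.
    apply: ge_ereal_sup => _ [E [F [EE FF PE0 ->]]]; rewrite lee_fin.
    have [rn0 rn1] := rn01 n.
    have mE := sigma_of_measurable EE; have mF := sigma_of_measurable FF.
    have FFC : sigma_of X [set i : int | n%:Z <= i] (~` F).
      exact: sigma_algebraC.
    have pE0 : 0 < fine (P E).
      by rewrite fine_gt0// PE0 (le_lt_trans (probability_le1 _ mE)) ?ltry.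
    have FC1 : fine (P (~` F)) = 1 - fine (P F).
      by rewrite probability_setC// fineB// fin_num_measure.
    have EFC : fine (P (E `&` ~` F)) = fine (P E) - fine (P (E `&` F)).
      rewrite -setDE measureD// ?fineB ?fin_num_measure//; first exact: measurableI.
      by rewrite (le_lt_trans (probability_le1 _ mE)) ?ltry.
    have lo := low n E F EE FF; have loC := low n E _ EE FFC.
    rewrite FC1 EFC in loC.
    rewrite [leRHS](_ : _ = 1 - (1 - (1 - a) ^+ n)); last by rewrite subKr.
    apply: dist_le_of_minor.
    * by rewrite subr_ge0.
    * by rewrite gerBl.
    * by rewrite fine_ge0.
    * by rewrite -lee_fin fineK ?probability_le1// fin_num_measure.
    * by rewrite ler_pdivlMr// -mulrA [fine (P F) * _]mulrC.
    * rewrite -(ler_pM2r pE0) [leRHS]mulrBl mul1r divfK ?gt_eqF//.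
      by rewrite -mulrA [(1 - fine (P F)) * _]mulrC.
  + exact: cvg_cst.
  + apply: cvg_EFin; first exact: nearW.
    by apply: cvg_expr; rewrite ger0_norm// ltW.
Qed.
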